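(* Let $\mathfrak{A}[\tau]$ be a *-semisimple, semi-associative topological partial *-algebra with multiplication core $\mathfrak{B}$ and unit $e\in\mathfrak{B}$. For $x\in\mathfrak{A}$ the following are equivalent: (i) $x$ is $\mathcal{P}_{\mathfrak{B}}(\mathfrak{A})$-bounded; (ii) $x\in\mathfrak{A}_b(\mathcal{P})$; (iii) $\pi(x)$ is bounded for every $(\tau,\mathsf{t}_s)$-continuous *-representation $\pi$ of $\mathfrak{A}$, and $\sup\{\|\overline{\pi(x)}\|:\pi$ a $(\tau,\mathsf{t}_s)$-continuous *-representation of $\mathfrak{A}\}<\infty$.
   Context: A partial *-algebra is a complex vector space $\mathfrak{A}$ with conjugate-linear involution and distributive partial multiplication on $\Gamma\subset\mathfrak{A}\times\mathfrak{A}$ with $(x,y)\in\Gamma$ iff $(y^*,x^* )\in\Gamma$, then $(xy)^*=y^*x^*$; $L(y)=\{x:(x,y)\in\Gamma\}$, $R(x)=\{y:(x,y)\in\Gamma\}$; $R\mathfrak{A}$, $L\mathfrak{A}$ universal right/left multipliers; unit $e=e^*\in R\mathfrak{A}\cap L\mathfrak{A}$ with $xe=ex=x$. Semi-associative: $y\in R(x)$ implies $yz\in R(x)$ and $(xy)z=x(yz)$ for $z\in R\mathfrak{A}$. Topological partial *-algebra: Hausdorff locally convex topology $\tau$ such that each map $y\in R(x)\mapsto xy$ is closed. $\tau^*$: seminorms $\max\{p(x),p(x^* )\}$. A multiplication core is a subspace $\mathfrak{B}\subseteq R\mathfrak{A}$ with: $e\in\mathfrak{B}$ if a unit exists; $\mathfrak{B}\mathfrak{B}\subseteq\mathfrak{B}$;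 $\mathfrak{B}$ $\tau^*$-dense; $x\mapsto xb$ $\tau$-continuous for $b\in\mathfrak{B}$; $b^*(xc)=(b^*x)c$. For a dense subspace $\mathcal{D}$ of a Hilbert space $\mathcal{H}$, $\mathcal{L}^\dagger(\mathcal{D},\mathcal{H})$ is the set of linear operators $X$ with domain $\mathcal{D}$ and $D(X^* )\supseteq\mathcal{D}$, $X^\dagger=X^*|_\mathcal{D}$, weak product $X_1\Box X_2=(X_1^\dagger)^*X_2$ when $X_2\mathcal{D}\subset D((X_1^\dagger)^* )$ and $X_1^*\mathcal{D}\subset D(X_2^* )$. A *-representation: linear $\pi:\mathfrak{A}\to\mathcal{L}^\dagger(\mathcal{D}(\pi),\mathcal{H})$ with $\pi(x^* )=\pi(x)^\dagger$ and $\pi(x)\Box\pi(y)=\pi(xy)$ (defined) whenever $x\in L(y)$; $(\tau,\mathsf{t}_s)$-continuous if $x\mapsto\pi(x)\xi$ is continuous for each $\xi\in\mathcal{D}(\pi)$. $\mathfrak{A}$ is *-semisimple if for each $x\ne0$ some $(\tau,\mathsf{t}_s)$-continuous *-representation $\pi$ has $\pi(x)\ne0$. An ips-form with core $\mathfrak{B}$ is a positive sesquilinear form $\varphi$ on $\mathfrak{A}\times\mathfrak{A}$ with $\mathfrak{B}\subset R\mathfrak{A}$, $\{x+N_\varphi:x\in\mathfrak{B}\}$ dense in the completion of $\mathfrak{A}/N_\varphi$ ($N_\varphi=\{x:\varphi(x,x)=0\}$), $\varphi(xa,b)=\varphi(a,x^*b)$ and $\varphi(x^*a,yb)=\varphi(a,(xy)b)$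 for $x\in L(y)$, $a,b\in\mathfrak{B}$. $\mathcal{P}=\mathcal{P}_{\mathfrak{B}}(\mathfrak{A})$: such forms that are $\tau$-continuous ($|\varphi(x,y)|\le p(x)p(y)$ for a continuous seminorm $p$). $x$ is $\mathcal{P}_{\mathfrak{B}}(\mathfrak{A})$-bounded if there is $\gamma_x>0$ with $|\varphi(xa,b)|\le\gamma_x\varphi(a,a)^{1/2}\varphi(b,b)^{1/2}$ for all $\varphi\in\mathcal{P}$, $a,b\in\mathfrak{B}$. $\mathfrak{A}^+_{\mathcal{P}}=\{x:\varphi(xa,a)\ge0\ \forall\varphi\in\mathcal{P},a\in\mathfrak{B}\}$, with order $x\le y\iff y-x\in\mathfrak{A}^+_{\mathcal{P}}$; $\mathfrak{A}_b(\mathcal{P})$ is the set of $x$ for which some $\gamma\ge0$ satisfies $\pm\Re(x)\le\gamma e$, $\pm\Im(x)\le\gamma e$ ($\Re(x)=\frac12(x+x^* )$, $\Im(x)=\frac1{2i}(x-x^* )$). *)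

(* Defs.v *)
From mathcomp Require Import all_boot all_order all_algebra.
From mathcomp Require Import reals complex.
From Stdlib Require List.
Set Implicit Arguments.
Unset Strict Implicit.
Unset Printing Implicit Defensive.
Import Order.TTheory GRing.Theory Num.Theory.
Local Open Scope ring_scope.
Local Open Scope complex_scope.

Record hilbert (R : realType) := Hilbert {
  hcar :> lmodType R[i];
  hip : hcar -> hcar -> R[i];
  hip_linear : forall (a : R[i]) (x y z : hcar),
      hip (a *: x + y) z = a * hip x z + hip y z;
  hip_herm : forall x y : hcar, hip y x = (hip x y)^*;
  hip_ge0 : forall x : hcar, 0 <= hip x x;
  hip_def : forall x : hcar, hip x x = 0 -> x = 0;
  hip_complete : forall u : nat -> hcar,
      (forall eps : R[i], 0 < eps -> exists N : nat, forall m n : nat,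
         (N <= m)%N -> (N <= n)%N -> sqrtC (hip (u m - u n) (u m - u n)) < eps) ->
      exists l : hcar, forall eps : R[i], 0 < eps -> exists N : nat, forall n : nat,
         (N <= n)%N -> sqrtC (hip (u n - l) (u n - l)) < eps
}.

Section HilbertDefs.
Context {R : realType} (H : hilbert R).

Definition hnorm (x : H) : R[i] := sqrtC (hip x x).

Definition hconv (u : nat -> H) (l : H) : Prop :=
  forall eps : R[i], 0 < eps -> exists N : nat, forall n : nat,
    (N <= n)%N -> hnorm (u n - l) < eps.

Definition dense_subspace (D : H -> Prop) : Prop :=
  D 0 /\ (forall (a : R[i]) x y, D x -> D y -> D (a *: x + y)) /\
  (forall (x : H) (eps : R[i]), 0 < eps -> exists y, D y /\ hnorm (x - y) < eps).

Definition adj_rel (D : H -> Prop) (X : H -> H) (eta zeta : H) : Prop :=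
  forall xi, D xi -> hip (X xi) eta = hip xi zeta.

Definition in_adj_dom (D : H -> Prop) (X : H -> H) (eta : H) : Prop :=
  exists zeta, adj_rel D X eta zeta.

Definition bounded_op (D : H -> Prop) (X : H -> H) : Prop :=
  exists c : R[i], forall xi, D xi -> hnorm (X xi) <= c * hnorm xi.

Definition closure_graph (D : H -> Prop) (X : H -> H) (xi eta : H) : Prop :=
  exists u : nat -> H, (forall n, D (u n)) /\ hconv u xi /\ hconv (fun n => X (u n)) eta.

Definition closure_norm_le (D : H -> Prop) (X : H -> H) (M : R[i]) : Prop :=
  forall xi eta, closure_graph D X xi eta -> hnorm eta <= M * hnorm xi.

End HilbertDefs.

(* A : complex vector space, star : involution, G : the set Gamma of   *)
(* composable pairs, mul : the partial multiplication (only its values *)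
(* on Gamma are meaningful).                                           *)

Section PartialStar.
Context {R : realType} {A : lmodType R[i]} (star : A -> A)
  (G : A -> A -> Prop) (mul : A -> A -> A).

Definition partial_star_algebra : Prop :=
  (forall x, star (star x) = x) /\
  (forall (a : R[i]) x y, star (a *: x + y) = a^* *: star x + star y) /\
  (forall x y, G x y <-> G (star y) (star x)) /\
  (forall x y, G x y -> star (mul x y) = mul (star y) (star x)) /\
  (forall x y z (a b : R[i]), G x y -> G x z ->
      G x (a *: y + b *: z) /\ mul x (a *: y + b *: z) = a *: mul x y + b *: mul x z) /\
  (forall x y z (a b : R[i]), G y x -> G z x ->
      G (a *: y + b *: z) x /\ mul (a *: y + b *: z) x = a *: mul y x + b *: mul z x).

Definition Lmul (y : A) : A -> Prop := fun x => G x y.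
Definition Rmul (x : A) : A -> Prop := fun y => G x y.
Definition RA : A -> Prop := fun y => forall x, G x y.
Definition LA : A -> Prop := fun x => forall y, G x y.

Definition is_unit (e : A) : Prop :=
  e = star e /\ RA e /\ LA e /\ (forall x, mul x e = x /\ mul e x = x).

Definition semi_associative : Prop :=
  forall x y z, G x y -> RA z -> G x (mul y z) /\ mul (mul x y) z = mul x (mul y z).

(* ---- the locally convex topology tau, generated by a family sn of  *)
(* seminorms indexed by I ---- *)
Context {I : Type} (sn : I -> A -> R).

Definition seminorm (p : A -> R) : Prop :=
  (forall x, 0 <= p x) /\ (forall x y, p (x + y) <= p x + p y) /\
  (forall (a : R[i]) x, (p (a *: x))%:C = `|a| * (p x)%:C).

Definition tau_near (s : seq I) (d : R) (x0 x : A) : Prop :=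
  forall i, List.In i s -> sn i (x - x0) < d.

Definition taustar_near (s : seq I) (d : R) (x0 x : A) : Prop :=
  forall i, List.In i s -> sn i (x - x0) < d /\ sn i (star (x - x0)) < d.

Definition locally_convex_hausdorff : Prop :=
  (forall i, seminorm (sn i)) /\ (forall x, (forall i, sn i x = 0) -> x = 0).

Definition tau_cont_seminorm (p : A -> R) : Prop :=
  seminorm p /\ exists (s : seq I) (c : R), 0 < c /\
    forall x, p x <= c * \sum_(i <- s) sn i x.

Definition tau_continuous (f : A -> A) : Prop :=
  forall x0 (j : I) (eps : R), 0 < eps -> exists (s : seq I) (d : R), 0 < d /\
    forall x, tau_near s d x0 x -> sn j (f x - f x0) < eps.

(* topological partial *-algebra: each y in R(x) |-> xy is closed *)
Definition topological_partial_star_algebra : Prop :=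
  partial_star_algebra /\ locally_convex_hausdorff /\
  forall x y z,
    (forall (s : seq I) (d : R), 0 < d ->
        exists y', G x y' /\ tau_near s d y y' /\ tau_near s d z (mul x y')) ->
    G x y /\ mul x y = z.

Definition multiplication_core (B : A -> Prop) (e : A) : Prop :=
  (B 0 /\ forall (a : R[i]) x y, B x -> B y -> B (a *: x + y)) /\
  (forall b, B b -> RA b) /\
  B e /\
  (forall b c, B b -> B c -> B (mul b c)) /\
  (forall x (s : seq I) (d : R), 0 < d -> exists b, B b /\ taustar_near s d x b) /\
  (forall b, B b -> tau_continuous (fun x => mul x b)) /\
  (forall x b c, B b -> B c -> mul (star b) (mul x c) = mul (mul (star b) x) c).

Definition star_rep (H : hilbert R) (D : H -> Prop) (pi : A -> H -> H) : Prop :=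
  dense_subspace D /\
  (forall x (a : R[i]) xi eta, D xi -> D eta ->
      pi x (a *: xi + eta) = a *: pi x xi + pi x eta) /\
  (forall x y (a : R[i]) xi, D xi -> pi (a *: x + y) xi = a *: pi x xi + pi y xi) /\
  (* pi(x) in L^dagger(D,H) and pi(x^* ) = pi(x)^dagger = pi(x)^* |_D *)
  (forall x xi eta, D xi -> D eta -> hip (pi x xi) eta = hip xi (pi (star x) eta)) /\
  (* x in L(y) ==> pi(x) [] pi(y) is defined and equals pi(xy);
     note pi(x)^dagger = pi(x^* ) on D *)
  (forall x y, G x y ->
      (forall xi, D xi -> in_adj_dom D (pi (star x)) (pi y xi)) /\
      (forall eta zeta, D eta -> adj_rel D (pi x) eta zeta -> in_adj_dom D (pi y) zeta) /\
      (forall xi, D xi -> adj_rel D (pi (star x)) (pi y xi) (pi (mul x y) xi))).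

Definition rep_continuous (H : hilbert R) (D : H -> Prop) (pi : A -> H -> H) : Prop :=
  forall xi, D xi -> forall x0 (eps : R[i]), 0 < eps ->
    exists (s : seq I) (d : R), 0 < d /\
      forall x, tau_near s d x0 x -> hnorm (pi x xi - pi x0 xi) < eps.

Definition cont_star_rep (H : hilbert R) (D : H -> Prop) (pi : A -> H -> H) : Prop :=
  star_rep D pi /\ rep_continuous D pi.

Definition star_semisimple : Prop :=
  forall x, x <> 0 -> exists (H : hilbert R) (D : H -> Prop) (pi : A -> H -> H),
    cont_star_rep D pi /\ exists xi, D xi /\ pi x xi <> 0.

Context (B : A -> Prop).

Definition ips_form (phi : A -> A -> R[i]) : Prop :=
  (forall (a : R[i]) x y z, phi (a *: x + y) z = a * phi x z + phi y z) /\
  (forall (a : R[i]) x y z, phi x (a *: y + z) = a^* * phi x y + phi x z) /\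
  (forall x, 0 <= phi x x) /\
  (forall b, B b -> RA b) /\
  (* {b + N_phi : b in B} is dense in the completion of A / N_phi *)
  (forall x (eps : R[i]), 0 < eps -> exists b, B b /\ phi (x - b) (x - b) < eps) /\
  (forall x a b, B a -> B b -> phi (mul x a) b = phi a (mul (star x) b)) /\
  (forall x y a b, G x y -> B a -> B b ->
      phi (mul (star x) a) (mul y b) = phi a (mul (mul x y) b)).

Definition in_P (phi : A -> A -> R[i]) : Prop :=
  ips_form phi /\ exists p, tau_cont_seminorm p /\
    forall x y, `|phi x y| <= (p x * p y)%:C.

Definition P_bounded (x : A) : Prop :=
  exists gamma : R[i], 0 < gamma /\ forall phi a b, in_P phi -> B a -> B b ->
    `|phi (mul x a) b| <= gamma * sqrtC (phi a a) * sqrtC (phi b b).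

Definition Apos (x : A) : Prop :=
  forall phi a, in_P phi -> B a -> 0 <= phi (mul x a) a.

Definition Ale (x y : A) : Prop := Apos (y - x).

Definition ReA (x : A) : A := 2^-1 *: (x + star x).
Definition ImA (x : A) : A := (2 * 'i)^-1 *: (x - star x).

Definition in_Ab (e : A) (x : A) : Prop :=
  exists gamma : R, 0 <= gamma /\
    Ale (ReA x) (gamma%:C *: e) /\ Ale (- ReA x) (gamma%:C *: e) /\
    Ale (ImA x) (gamma%:C *: e) /\ Ale (- ImA x) (gamma%:C *: e).

Definition rep_bounded (x : A) : Prop :=
  (forall (H : hilbert R) (D : H -> Prop) (pi : A -> H -> H),
      cont_star_rep D pi -> bounded_op D (pi x)) /\
  exists M : R[i], forall (H : hilbert R) (D : H -> Prop) (pi : A -> H -> H),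
      cont_star_rep D pi -> closure_norm_le D (pi x) M.

End PartialStar.

(* Main.v *)
(** A vector [xi] in the domain of a continuous *-representation [pi] yields the
ips-form [(x, y) |-> <pi x xi, pi y xi>], which is in P; semi-associativity and the
core identity give its invariance.  Testing an order bound for [x] on these forms at
[e] bounds the numerical radius of [pi x], hence its norm, independently of [pi].
Conversely every [phi] in P arises from its GNS representation on the completion of
A / N_phi with domain the image of B, so that a uniform bound on the norms of the
[pi x] gives back P_B-boundedness, which trivially implies an order bound. *)

Require Import Defs.
From HB Require Import structures.
From mathcomp Require Import all_boot all_order all_algebra.
From mathcomp Require Import reals complex boolp classical_sets functions ring lra.
Set Implicit Arguments.
Unset Strict Implicit.
Unset Printing Implicit Defensive.
Import Order.TTheory GRing.Theory Num.Theory Normc.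
Local Open Scope ring_scope.
Local Open Scope complex_scope.

Arguments normc : simpl never.

(** An order bound sees only the diagonal values [phi (mul x a) a], through their real and imaginary
    parts, whereas the norm of [pi x] involves all [hip (pi x xi) eta]. Joining the two parts costs
    a factor 2 and polarizing costs a factor 6, so an order bound g gives the operator bound 12 g;
    only its independence of [pi] matters. Nothing in [star_rep] makes [pi e] the identity, so
    testing a vector form at [e] yields [hip (pi x xi) (pi e xi)]. The weak product law with
    [star e = e] shows that [pi e] is a contraction and may be dropped from this pairing. For the
    GNS direction only elements of the core can be multiplied on the left by every x, which is why
    the domain is the image of B. That [lam b] determines [lam (mul x b)] is not a property of the
    null space alone: it follows from the adjoint law of [phi] and the density of that domain. The
    second domain condition of the weak product is met by computing the adjoint explicitly on the
    domain. The completion consists of functionals, so that passing to the quotient by N_phi and by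
    null sequences becomes mere equality of functions. *)

Section ComplexFacts.
Context {R : realType}.
Implicit Types (z : R[i]) (r : R).

Lemma normC_normc z : `|z| = (normc z)%:C.
Proof. by rewrite normc_def; case: z. Qed.

Lemma normc_ge0 z : 0 <= normc z.
Proof. by case: z => a b; rewrite /normc sqrtr_ge0. Qed.

Lemma sqr_normcE z : normc z ^+ 2 = complex.Re z ^+ 2 + complex.Im z ^+ 2.
Proof. by case: z => a b; rewrite /normc sqr_sqrtr // addr_ge0 // sqr_ge0. Qed.

Lemma ge0_real z : 0 <= z -> z = (complex.Re z)%:C.
Proof. by case: z => a b; rewrite lecE /= => /andP[/eqP -> _]. Qed.

Lemma normc_real r : normc r%:C = `|r|.
Proof. by rewrite /normc /= expr0n /= addr0 sqrtr_sqr. Qed.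

Lemma sqrtC_real z : 0 <= z -> sqrtC z = (Num.sqrt (complex.Re z))%:C.
Proof.
move=> z0; have r0 : 0 <= complex.Re z by move: z0; rewrite lecE => /andP[].
apply/eqP; rewrite -(@eqrXn2 _ 2) ?sqrtC_ge0 ?lecR ?sqrtr_ge0 //.
by rewrite sqrtCK -rmorphXn /= sqr_sqrtr // -ge0_real.
Qed.

Lemma norm_Re_le z : `|complex.Re z| <= normc z.
Proof.
by rewrite -ler_sqr ?nnegrE ?normc_ge0 // sqr_normcE real_normK ?num_real // lerDl sqr_ge0.
Qed.

Lemma norm_Im_le z : `|complex.Im z| <= normc z.
Proof.
by rewrite -ler_sqr ?nnegrE ?normc_ge0 // sqr_normcE real_normK ?num_real // lerDr sqr_ge0.
Qed.

Lemma Re_le_normc z : complex.Re z <= normc z.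
Proof. exact: le_trans (ler_norm _) (norm_Re_le z). Qed.

Lemma normc_le z : normc z <= `|complex.Re z| + `|complex.Im z|.
Proof.
rewrite -ler_sqr ?nnegrE ?normc_ge0 ?addr_ge0 // sqr_normcE sqrrD !real_normK ?num_real //.
by rewrite addrAC lerDl mulrn_wge0 // mulr_ge0.
Qed.

Lemma le_normC r z : r%:C <= z -> r <= normc z.
Proof. by rewrite lecE => /andP[_ h]; exact: le_trans h (Re_le_normc z). Qed.

Lemma normc_conj z : normc z^* = normc z.
Proof. by case: z => a b; rewrite /normc /= sqrrN. Qed.

Lemma normcB z z' : normc (z - z') = normc (z' - z).
Proof. by rewrite -normcN opprB. Qed.

End ComplexFacts.

(** * Sequential limits and completeness of the complex numbers *)

Section Limits.
Context {R : realType}.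
Implicit Types (u v : nat -> R[i]) (l : R[i]).

Definition cvgC u l := forall eps : R, 0 < eps ->
  exists N, forall n, (N <= n)%N -> normc (u n - l) < eps.

Lemma cvgC_unique u l l' : cvgC u l -> cvgC u l' -> l = l'.
Proof.
move=> ul ul'; apply/eqP; rewrite -subr_eq0; apply/negPn/negP => d0.
have e0 : 0 < normc (l - l') / 2.
  rewrite divr_gt0 // lt_neqAle normc_ge0 andbT eq_sym.
  by apply: contra d0 => /eqP/eq0_normc ->.
have [N hN] := ul _ e0; have [N' hN'] := ul' _ e0.
have := hN _ (leq_maxl N N'); have := hN' _ (leq_maxr N N').
set n := maxn N N' => h1 h2.
have := le_normcD (l - u n) (u n - l'); rewrite addrA subrK (normcB l (u n)).
lra.
Qed.

Lemma eq_cvgC u v l : (forall n, u n = v n) -> cvgC u l -> cvgC v l.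
Proof. by move=> uv ul e /ul[N h]; exists N => n /h; rewrite uv. Qed.

Lemma cvgC_cst l : cvgC (fun=> l) l.
Proof. by move=> e e0; exists 0%N => n _; rewrite subrr normc0. Qed.

Lemma cvgC_lin (a : R[i]) u v l l' :
  cvgC u l -> cvgC v l' -> cvgC (fun n => a * u n + v n) (a * l + l').
Proof.
move=> ul vl e e0; have a0 := normc_ge0 a.
have ea : 0 < e / 2 / (normc a + 1) by rewrite !divr_gt0 //; lra.
have e2 : 0 < e / 2 by lra.
have [N h] := ul _ ea; have [N' h'] := vl _ e2.
exists (maxn N N') => n; rewrite geq_max => /andP[/h hu /h' hv].
have -> : a * u n + v n - (a * l + l') = a * (u n - l) + (v n - l') by ring.
have := le_normcD (a * (u n - l)) (v n - l'); rewrite normcM.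
have : normc a * normc (u n - l) <= (normc a + 1) * (e / 2 / (normc a + 1)).
  by apply: ler_pM; rewrite ?normc_ge0 //; lra.
rewrite [leRHS]mulrC divfK; lra.
Qed.

Lemma cvgC_conj u l : cvgC u l -> cvgC (fun n => (u n)^*) l^*.
Proof. by move=> ul e /ul[N h]; exists N => n /h; rewrite -rmorphB normc_conj. Qed.

Lemma cvgC_Re_le u l (r : R) N : cvgC u l ->
  (forall n, (N <= n)%N -> complex.Re (u n) <= r) -> complex.Re l <= r.
Proof.
move=> ul ur; apply/ler_addgt0Pr => e /ul[M h].
have := h _ (leq_maxr N M); have := ur _ (leq_maxl N M); rewrite normcB.
have := Re_le_normc (l - u (maxn N M)); rewrite raddfB /=; lra.
Qed.

(** The order on [R[i]] contains reality: the limit is real because u equals its conjugate sequence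
    and limits are unique. The sign comes from [cvgC_Re_le] applied to the opposite sequence. *)
Lemma cvgC_ge0 u l : cvgC u l -> (forall n, 0 <= u n) -> 0 <= l.
Proof.
move=> ul u0.
have h1 : cvgC (fun n => (u n)^*) l.
  by apply: eq_cvgC ul => n; rewrite [u n]ge0_real // conjc_real.
have Il := cvgC_unique (cvgC_conj ul) h1.
have hR := cvgC_Re_le (N := 0%N) (r := 0) (cvgC_lin (-1) ul (cvgC_cst 0)).
have {}hR : 0 <= complex.Re l.
  move: hR; rewrite addr0 mulN1r raddfN /= oppr_le0; apply => n _.
  have := u0 n; rewrite addr0 mulN1r raddfN /= oppr_le0 lecE => /andP[] //.
rewrite lecE /= hR andbT; move: Il; case: (l) => a b [] /= bb; apply/eqP; lra.
Qed.

(** The limit is taken to be the lower limit, that is, the supremum of the set S of eventual lower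
    bounds. A Cauchy index N for e puts [u N - e] in S and makes [u N + e] an upper bound of S. *)
Lemma cauchy_cvgR (u : nat -> R) :
  (forall eps : R, 0 < eps -> exists N, forall n, (N <= n)%N -> `|u n - u N| < eps) ->
  exists l : R, forall eps : R, 0 < eps -> exists N, forall n, (N <= n)%N -> `|u n - l| < eps.
Proof.
move=> cu.
pose S : set R := fun x => exists N, forall n, (N <= n)%N -> x <= u n.
have SN e N : (forall n, (N <= n)%N -> `|u n - u N| < e) -> S (u N - e).
  move=> h; exists N => n /h; rewrite ltr_norml; lra.
have Sub e N : (forall n, (N <= n)%N -> `|u n - u N| < e) ->
    ubound S (u N + e).
  move=> h x [M hM]; have := hM _ (leq_maxr N M); have := h _ (leq_maxl N M).
  by rewrite ltr_norml; lra.
have [N0 h0] := cu 1 ltr01.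
have hs : has_sup S.
  by split; [exists (u N0 - 1); exact: SN h0|exists (u N0 + 1); exact: Sub h0].
exists (sup S) => e e0; have e2 : 0 < e / 2 by lra.
have [N hN] := cu _ e2; exists N => n /hN.
have := ge_sup hs.1 (Sub _ _ hN); have := ub_le_sup hs.2 (SN _ _ hN).
rewrite !ltr_norml; lra.
Qed.

Lemma cauchy_cvgC u :
  (forall eps : R, 0 < eps -> exists N, forall n, (N <= n)%N -> normc (u n - u N) < eps) ->
  exists l, cvgC u l.
Proof.
move=> cu.
have [|a ha] := @cauchy_cvgR (fun n => complex.Re (u n)).
  by move=> e /cu[N h]; exists N => n /h; rewrite -raddfB; apply: le_lt_trans (norm_Re_le _).
have [|b hb] := @cauchy_cvgR (fun n => complex.Im (u n)).
  by move=> e /cu[N h]; exists N => n /h; rewrite -raddfB; apply: le_lt_trans (norm_Im_le _).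
exists (a +i* b) => e e0; have e2 : 0 < e / 2 by lra.
have [N h] := ha _ e2; have [N' h'] := hb _ e2.
exists (maxn N N') => n; rewrite geq_max => /andP[/h + /h'].
have := normc_le (u n - (a +i* b)); rewrite !raddfB /=; lra.
Qed.

End Limits.

(** * Cauchy-Schwarz and the triangle inequality for a form positive on a subspace *)

Section PositiveForm.
Context {R : realType} {V : lmodType R[i]}.

Definition subspace (D : V -> Prop) :=
  D 0 /\ forall (a : R[i]) x y, D x -> D y -> D (a *: x + y).

(** The laws are required on D only, because forms built from [hip (pi x u) v] are linear in u only
    on the domain of the representation. *)
Definition pos_form (D : V -> Prop) (f : V -> V -> R[i]) :=
  [/\ forall (a : R[i]) x y z, D x -> D y -> D z -> f (a *: x + y) z = a * f x z + f y z,
      forall x y, D x -> D y -> f y x = (f x y)^* &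
      forall x, D x -> 0 <= f x x].

Definition fnorm (f : V -> V -> R[i]) (x : V) : R := Num.sqrt (complex.Re (f x x)).

Variables (D : V -> Prop) (f : V -> V -> R[i]).
Hypotheses (sD : subspace D) (pf : pos_form D f).
Implicit Types x y z : V.

Lemma form_linr (a : R[i]) x y z : D x -> D y -> D z ->
  f x (a *: y + z) = a^* * f x y + f x z.
Proof.
move=> Dx Dy Dz; have [l h _] := pf; have Da := sD.2 a _ _ Dy Dz.
by rewrite (h _ _ Da Dx) l // rmorphD rmorphM /= -!h.
Qed.

Lemma form_self x : D x -> f x x = (fnorm f x ^+ 2)%:C.
Proof.
move=> Dx; have [_ _ /(_ _ Dx) p] := pf.
by rewrite /fnorm sqr_sqrtr -?ge0_real //; move: p; rewrite lecE => /andP[].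
Qed.

Lemma fnorm_ge0 x : 0 <= fnorm f x. Proof. exact: sqrtr_ge0. Qed.

Lemma fnormC x : D x -> sqrtC (f x x) = (fnorm f x)%:C.
Proof. by move=> Dx; have [_ _ p] := pf; rewrite sqrtC_real // p. Qed.

Lemma form_expand (t : R[i]) x y : D x -> D y ->
  f (t *: y + x) (t *: y + x) =
  t * t^* * f y y + t * (f x y)^* + t^* * f x y + f x x.
Proof.
move=> Dx Dy; have [l h _] := pf; have Dt := sD.2 t _ _ Dy Dx.
by rewrite l // !form_linr // (h x y) //; ring.
Qed.

Lemma cauchy_schwarz x y : D x -> D y -> normc (f x y) <= fnorm f x * fnorm f y.
Proof.
move=> Dx Dy; have [l h p] := pf.
rewrite -ler_sqr ?nnegrE ?mulr_ge0 ?fnorm_ge0 ?normc_ge0 // exprMn.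
(* Positivity of f at [x - s (f x y) y], a quadratic polynomial in the real s. Its minimum, at the
   inverse of [fnorm f y ^+ 2], gives the inequality when y is not null. *)
have q (s : R) : 0 <= s ^+ 2 * normc (f x y) ^+ 2 * fnorm f y ^+ 2
    - 2 * s * normc (f x y) ^+ 2 + fnorm f x ^+ 2.
  have := p _ (sD.2 (- (s%:C * f x y)) _ _ Dy Dx).
  rewrite form_expand // (form_self Dx) (form_self Dy) lecE => /andP[_] /=.
  rewrite sqr_normcE; case: (f x y) => a b /=; rewrite /= => H.
  by apply: le_trans H _; rewrite le_eqVlt; apply/orP; left; apply/eqP; ring.
have c0 : 0 <= fnorm f y ^+ 2 by exact: sqr_ge0.
have k0 : 0 <= normc (f x y) ^+ 2 by exact: sqr_ge0.
move: (_ ^+ 2) (_ ^+ 2) (_ ^+ 2) c0 k0 q => a k c c0 k0 q.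
have [c1|c1] := ltP 0 c.
  have := q c^-1; have -> : c^-1 ^+ 2 * k * c - 2 * c^-1 * k + a = a - k / c.
    by field; rewrite gt_eqF.
  by rewrite subr_ge0 ler_pdivrMr.
have -> : c = 0 by lra.
rewrite mulr0 leNgt; apply/negP => k1.
(* For null y the polynomial is affine in s; this s would give it the value -1. *)
have := q ((a + 1) / (2 * k)); have -> : c = 0 by lra.
have -> : 2 * ((a + 1) / (2 * k)) * k = a + 1 by field; rewrite gt_eqF.
lra.
Qed.

Lemma fnormD x y : D x -> D y -> fnorm f (x + y) <= fnorm f x + fnorm f y.
Proof.
move=> Dx Dy; rewrite -ler_sqr ?nnegrE ?addr_ge0 ?fnorm_ge0 //.
have D1 : D (x + y) by rewrite -[x]scale1r; exact: sD.2.
have := form_self D1; have := form_expand 1 Dy Dx; rewrite scale1r => ->.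
move=> /(congr1 (@complex.Re R)) /=.
rewrite (form_self Dx) (form_self Dy).
have := le_trans (Re_le_normc _) (cauchy_schwarz Dy Dx).
by case: (f y x) => a b /=; nra.
Qed.

Lemma posform0l y : D y -> f 0 y = 0.
Proof.
move=> Dy; have [l _ _] := pf; have := l 1 0 0 y sD.1 sD.1 Dy.
by rewrite scaler0 addr0 mul1r => /eqP; rewrite -subr_eq subrr eq_sym => /eqP.
Qed.

Lemma fnormN x : D x -> fnorm f (- x) = fnorm f x.
Proof.
move=> Dx; rewrite /fnorm -[- x]addr0 -scaleN1r form_expand //; last exact: sD.1.
rewrite posform0l // posform0l ?rmorph0 ?mulr0 ?addr0; last exact: sD.1.
by rewrite rmorphN rmorph1 mulrNN mulr1 mul1r.
Qed.

End PositiveForm.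

(** * Completion of a positive hermitian form *)

Section FullForm.
Context {R : realType} {V : lmodType R[i]} (f : V -> V -> R[i]).
Hypothesis pf : pos_form (fun=> True) f.

Lemma subspaceT : subspace (fun _ : V => True). Proof. by []. Qed.

Lemma formlin (a : R[i]) x y z : f (a *: x + y) z = a * f x z + f y z.
Proof. by have [l _ _] := pf; exact: l. Qed.

Lemma form_conj x y : f y x = (f x y)^*.
Proof. by have [_ h _] := pf; exact: h. Qed.

Lemma form_ge0 x : 0 <= f x x.
Proof. by have [_ _ p] := pf; exact: p. Qed.

Lemma formBl x y z : f (x - y) z = f x z - f y z.
Proof. by rewrite addrC -scaleN1r formlin mulN1r addrC. Qed.

Lemma formBr x y z : f z (x - y) = f z x - f z y.
Proof. by rewrite form_conj formBl rmorphB /= -!form_conj. Qed.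

Lemma form_normc_le x y : normc (f x y) <= fnorm f x * fnorm f y.
Proof. exact: (cauchy_schwarz subspaceT pf). Qed.

Lemma fnorm_triangle x y : fnorm f (x + y) <= fnorm f x + fnorm f y.
Proof. exact: (fnormD subspaceT pf). Qed.

Lemma fnorm_sym x y : fnorm f (x - y) = fnorm f (y - x).
Proof. by rewrite -(fnormN subspaceT pf) // opprB. Qed.

Lemma fnorm_sqr x : f x x = (fnorm f x ^+ 2)%:C.
Proof. exact: (form_self pf). Qed.

Lemma fnorm0 : fnorm f 0 = 0.
Proof. by rewrite /fnorm (posform0l subspaceT pf) // sqrtr0. Qed.

Lemma fnormZ (a : R[i]) x : fnorm f (a *: x) = normc a * fnorm f x.
Proof.
apply/eqP; rewrite -(@eqrXn2 _ 2) ?mulr_ge0 ?fnorm_ge0 ?normc_ge0 //.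
have := form_expand subspaceT pf a (x := 0) (y := x) I I.
rewrite addr0 !fnorm_sqr fnorm0 expr0n !(posform0l subspaceT pf) //.
rewrite rmorph0 !mulr0 !addr0 => /(congr1 (@complex.Re R)) /=.
move=> ->; rewrite exprMn sqr_normcE; case: a => p q /=; apply/eqP; ring.
Qed.

End FullForm.

Section Completion.
Context {R : realType} {V : lmodType R[i]} (f : V -> V -> R[i]).
Hypothesis pf : pos_form (fun=> True) f.
Implicit Types (u v : nat -> V) (F : V -> R[i]^o).

Definition cauchy_seq u := forall eps : R, 0 < eps ->
  exists N, forall m n, (N <= m)%N -> (N <= n)%N -> fnorm f (u m - u n) < eps.

Definition null_seq u := forall eps : R, 0 < eps ->
  exists N, forall n, (N <= n)%N -> fnorm f (u n) < eps.

(** A Cauchy sequence is recorded by its weak limit F. Sequences that differ by a null sequence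
    share F, and [represents_null] gives the converse, so F is a faithful name for a point of the
    completion. The codomain [R[i]^o] makes such functions a module. *)
Definition represents u F :=
  cauchy_seq u /\ forall y, cvgC (fun n => f (u n) y) (F y).

Lemma cauchy_cst x : cauchy_seq (fun=> x).
Proof.
move=> e e0; exists 0%N => m n _ _; rewrite subrr.
by rewrite -(scale0r x) (fnormZ pf) normc0 mul0r.
Qed.

Lemma cauchy_lin (a : R[i]) u v :
  cauchy_seq u -> cauchy_seq v -> cauchy_seq (fun n => a *: u n + v n).
Proof.
move=> cu cv e e0; have a0 := normc_ge0 a.
have ea : 0 < e / 2 / (normc a + 1) by rewrite !divr_gt0 //; lra.
have e2 : 0 < e / 2 by lra.
have [N h] := cu _ ea; have [N' h'] := cv _ e2.
exists (maxn N N') => m n; rewrite !geq_max => /andP[m1 m2] /andP[n1 n2].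
have := h _ _ m1 n1; have := h' _ _ m2 n2.
have -> : a *: u m + v m - (a *: u n + v n) = a *: (u m - u n) + (v m - v n).
  by rewrite scalerBr opprD addrACA.
have := fnorm_triangle pf (a *: (u m - u n)) (v m - v n); rewrite (fnormZ pf) => tr hv hu.
have : normc a * fnorm f (u m - u n) <= (normc a + 1) * (e / 2 / (normc a + 1)).
  by apply: ler_pM; rewrite ?fnorm_ge0 //; lra.
rewrite [leRHS]mulrC divfK; lra.
Qed.

Lemma cauchy_bounded u : cauchy_seq u ->
  exists b, 0 < b /\ exists N, forall n, (N <= n)%N -> fnorm f (u n) <= b.
Proof.
move=> cu; have [N h] := cu 1 ltr01; have := fnorm_ge0 f (u N).
exists (fnorm f (u N) + 1); split; first lra.
exists N => n nN; have := h _ _ nN (leqnn N).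
have := fnorm_triangle pf (u n - u N) (u N); rewrite subrK; lra.
Qed.

Lemma null_cvg u v : null_seq u -> cauchy_seq v -> cvgC (fun n => f (u n) (v n)) 0.
Proof.
move=> nu /cauchy_bounded[b [b0 [N h]]] e e0.
have [|M hM] := nu (e / b); first by rewrite divr_gt0.
exists (maxn N M) => n; rewrite geq_max => /andP[/h h1 /hM h2].
rewrite subr0; apply: le_lt_trans (form_normc_le pf _ _) _.
apply: le_lt_trans (ler_wpM2l (fnorm_ge0 f _) h1) _.
by rewrite -ltr_pdivlMr.
Qed.

Lemma cauchy_form_cvg u v : cauchy_seq u -> cauchy_seq v ->
  exists l, cvgC (fun n => f (u n) (v n)) l.
Proof.
move=> cu cv; apply: cauchy_cvgC => e e0.
have [b [b0 [N hb]]] := cauchy_bounded cu; have [c [c0 [M hc]]] := cauchy_bounded cv.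
have eb : 0 < e / 2 / b by rewrite !divr_gt0.
have ec : 0 < e / 2 / c by rewrite !divr_gt0.
have [N' hu] := cu _ ec; have [M' hv] := cv _ eb.
pose K := maxn (maxn N M) (maxn N' M'); exists K => n nK.
have /and4P[KN KM KN' KM'] : [&& N <= K, M <= K, N' <= K & M' <= K]%N.
  by rewrite /K !leq_max !leqnn ?orbT.
have -> : f (u n) (v n) - f (u K) (v K) =
    f (u n - u K) (v n) + f (u K) (v n - v K).
  by rewrite (formBl pf) (formBr pf); ring.
apply: le_lt_trans (le_normcD _ _) _.
have h1 : normc (f (u n - u K) (v n)) < e / 2.
  apply: le_lt_trans (form_normc_le pf _ _) _.
  apply: le_lt_trans (ler_wpM2l (fnorm_ge0 f _) (hc _ (leq_trans KM nK))) _.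
  by rewrite -ltr_pdivlMr //; apply: hu => //; exact: leq_trans nK.
have h2 : normc (f (u K) (v n - v K)) < e / 2.
  apply: le_lt_trans (form_normc_le pf _ _) _.
  apply: le_lt_trans (ler_wpM2r (fnorm_ge0 f _) (hb _ KN)) _.
  by rewrite mulrC -ltr_pdivlMr //; apply: hv => //; exact: leq_trans nK.
lra.
Qed.

(* |u n|^2 = <u n, u n - u N> + <u n, u N>: the first term is small since u is
   Cauchy, the second because u converges weakly to 0. *)
Lemma weakly_null u : cauchy_seq u -> (forall y, cvgC (fun n => f (u n) y) 0) ->
  null_seq u.
Proof.
move=> cu w e e0; have [b [b0 [N hb]]] := cauchy_bounded cu.
have e2 : 0 < e ^+ 2 / 2 by rewrite divr_gt0 // exprn_gt0.
have eb : 0 < e ^+ 2 / 2 / b by rewrite divr_gt0.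
have [M hM] := cu _ eb; have [K hK] := w (u M) _ e2.
exists (maxn N (maxn M K)) => n; rewrite !geq_max => /and3P[/hb nN nM /hK].
rewrite subr0 => nK; rewrite -ltr_sqr ?nnegrE ?fnorm_ge0 ?ltW //.
have -> : fnorm f (u n) ^+ 2 = complex.Re (f (u n) (u n - u M) + f (u n) (u M)).
  by rewrite (formBr pf) subrK (fnorm_sqr pf).
apply: le_lt_trans (Re_le_normc _) _; apply: le_lt_trans (le_normcD _ _) _.
have h1 : normc (f (u n) (u n - u M)) < e ^+ 2 / 2.
  apply: le_lt_trans (form_normc_le pf _ _) _.
  apply: le_lt_trans (ler_wpM2r (fnorm_ge0 f _) nN) _.
  by rewrite mulrC -ltr_pdivlMr //; exact: hM.
lra.
Qed.

Lemma represents_lin (a : R[i]) u v F F' :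
  represents u F -> represents v F' ->
  represents (fun n => a *: u n + v n) (a *: F + F').
Proof.
move=> [cu hu] [cv hv]; split; first exact: cauchy_lin.
move=> y; apply: eq_cvgC (cvgC_lin a (hu y) (hv y)) => n.
by rewrite (formlin pf).
Qed.

Lemma represents_cst x : represents (fun=> x) (f x).
Proof. by split; [exact: cauchy_cst | move=> y; exact: cvgC_cst]. Qed.

(** The difference is Cauchy and represents the zero functional, so it converges weakly to 0 and
    [weakly_null] upgrades this to the norm. *)
Lemma represents_null u v F : represents u F -> represents v F ->
  null_seq (fun n => u n - v n).
Proof.
move=> ru rv; have [c h] := represents_lin (-1) rv ru.
have E n : -1 *: v n + u n = u n - v n by rewrite scaleN1r addrC.
move: c h; under eq_fun do rewrite E; move=> c h; apply: weakly_null => // y.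
have := h y; have -> : (-1 *: F + F) y = 0 by rewrite scaleN1r addNr.
by apply: eq_cvgC => n; rewrite E.
Qed.

(** Frees the inner product [cip] from the representatives picked by choice. The pairing of u' with
    v' is that of u' - u with v', plus that of u with v' - v, plus that of u with v; the first two
    tend to 0. *)
Lemma represents_cvg u u' v v' F F' l :
  represents u F -> represents u' F -> represents v F' -> represents v' F' ->
  cvgC (fun n => f (u n) (v n)) l -> cvgC (fun n => f (u' n) (v' n)) l.
Proof.
move=> ru ru' rv rv' h.
have h1 := null_cvg (represents_null ru' ru) rv'.1.
have h2 := cvgC_conj (null_cvg (represents_null rv' rv) ru.1).
have := cvgC_lin 1 h1 (cvgC_lin 1 h2 h); rewrite rmorph0 mulr0 !add0r.
by apply: eq_cvgC => n; rewrite /= -(form_conj pf) (formBl pf) (formBr pf); ring.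
Qed.

Definition completion_pred : {pred V -> R[i]^o} :=
  fun F => `[< exists u, represents u F >].

Lemma completion_submod : submod_closed completion_pred.
Proof.
split=> [|a F F' /asboolP[u hu] /asboolP[v hv]]; apply/asboolP.
  exists (fun=> 0); have := represents_lin (-1) (represents_cst 0) (represents_cst 0).
  by rewrite /= scaleN1r addNr scaleN1r addNr.
by exists (fun n => a *: u n + v n); exact: represents_lin.
Qed.

HB.instance Definition _ :=
  GRing.isSubmodClosed.Build R[i] (V -> R[i]^o) completion_pred completion_submod.

(* The completion is modelled as the functionals y |-> lim f (u n) y, where u
   runs through the Cauchy sequences. *)
Record completion := Completion
  { functional : V -> R[i]^o; functionalP : functional \in completion_pred }.

HB.instance Definition _ := [isSub for functional].
HB.instance Definition _ := [Choice of completion by <:].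
HB.instance Definition _ := [SubChoice_isSubLmodule of completion by <:].

Implicit Types h k : completion.

Lemma represented h : {u | represents u (functional h)}.
Proof. by apply: cid; exact/asboolP/functionalP. Qed.

Definition cip h k : R[i] :=
  projT1 (cid (cauchy_form_cvg (projT2 (represented h)).1 (projT2 (represented k)).1)).

Lemma cip_cvg u v h k : represents u (functional h) -> represents v (functional k) ->
  cvgC (fun n => f (u n) (v n)) (cip h k).
Proof.
move=> hu kv; rewrite /cip; case: cid => l /=.
exact: (represents_cvg (projT2 (represented h)) hu (projT2 (represented k)) kv).
Qed.

Lemma functional_lin (a : R[i]) h k :
  functional (a *: h + k) = a *: functional h + functional k.
Proof. by []. Qed.

Lemma cip_form : pos_form (fun=> True) cip.
Proof.
split=> [a h k g _ _ _|h k _ _|h _].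
- have [u hu] := represented h; have [v kv] := represented k.
  have [w gw] := represented g.
  have hk : represents (fun n => a *: u n + v n) (functional (a *: h + k)).
    by rewrite functional_lin; exact: represents_lin.
  apply: cvgC_unique (cip_cvg hk gw) _.
  apply: eq_cvgC (cvgC_lin a (cip_cvg hu gw) (cip_cvg kv gw)) => n.
  by rewrite (formlin pf).
- have [u hu] := represented h; have [v kv] := represented k.
  apply: cvgC_unique (cip_cvg kv hu) _.
  by apply: eq_cvgC (cvgC_conj (cip_cvg hu kv)) => n; rewrite -(form_conj pf).
- have [u hu] := represented h; apply: cvgC_ge0 (cip_cvg hu hu) _ => n.
  exact: form_ge0.
Qed.

Lemma embedP x : (f x : V -> R[i]^o) \in completion_pred.
Proof. by apply/asboolP; exists (fun=> x); exact: represents_cst. Qed.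

Definition embed x := Completion (embedP x).

Lemma embed_lin (a : R[i]) x y : embed (a *: x + y) = a *: embed x + embed y.
Proof. by apply: val_inj; apply/funext => z; exact: (formlin pf). Qed.

(** A reproducing property: the constant sequence y represents [embed y], and pairing along it is
    the limit that defines [functional h]. *)
Lemma cip_embed h y : cip h (embed y) = functional h y.
Proof.
have [u hu] := represented h.
exact: (cvgC_unique (cip_cvg (k := embed y) hu (represents_cst y)) (hu.2 y)).
Qed.

(** Cauchy-Schwarz kills the pairings of h with embedded vectors, and by [cip_embed] these are all
    the values of its functional. *)
Lemma cip_def h : cip h h = 0 -> h = 0.
Proof.
move=> h0; apply: val_inj; apply/funext => y; rewrite -[LHS]cip_embed.
apply: eq0_normc; apply/eqP; rewrite eq_le normc_ge0 andbT.
by apply: le_trans (form_normc_le cip_form _ _) _; rewrite {1}/fnorm h0 sqrtr0 mul0r.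
Qed.

(** For fixed n the vector [h - embed (u n)] is represented by m |-> u m - u n, so its squared norm
    is a limit in m of quantities that the Cauchy property bounds. *)
Lemma embed_cvg u h : represents u (functional h) -> forall eps : R, 0 < eps ->
  exists N, forall n, (N <= n)%N -> fnorm cip (h - embed (u n)) < eps.
Proof.
move=> hu e e0; have e2 : 0 < e / 2 by lra.
have [N hN] := hu.1 _ e2; exists N => n nN.
suff : fnorm cip (h - embed (u n)) <= e / 2 by lra.
rewrite -ler_sqr ?nnegrE ?fnorm_ge0 ?(ltW e2) //.
have E : h - embed (u n) = -1 *: embed (u n) + h by rewrite scaleN1r addrC.
have r : represents (fun m => -1 *: u n + u m) (functional (h - embed (u n))).
  by rewrite E functional_lin; apply: represents_lin hu; exact: represents_cst.
have := cvgC_Re_le (N := N) (r := (e / 2) ^+ 2) (cip_cvg r r).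
rewrite (fnorm_sqr cip_form) /=; apply=> m mN.
rewrite (fnorm_sqr pf) /= ler_sqr ?nnegrE ?fnorm_ge0 ?(ltW e2) //; apply: ltW.
by rewrite scaleN1r addrC; exact: hN.
Qed.

Lemma embed_dense h (eps : R) : 0 < eps -> exists x, fnorm cip (h - embed x) < eps.
Proof.
move=> e0; have [u hu] := represented h; have [N hN] := embed_cvg hu e0.
by exists (u N); exact: hN.
Qed.

Lemma cip_complete (s : nat -> completion) :
  (forall eps : R, 0 < eps -> exists N, forall m n, (N <= m)%N -> (N <= n)%N ->
     fnorm cip (s m - s n) < eps) ->
  exists l, forall eps : R, 0 < eps -> exists N, forall n, (N <= n)%N ->
     fnorm cip (s n - l) < eps.
Proof.
move=> cs.
have inv_gt0 n : 0 < n.+1%:R^-1 :> R by rewrite invr_gt0 ltr0n.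
(* Diagonal argument: [s n] is replaced by an embedded vector within 1/(n+1). The sequence y is then
   Cauchy for f itself, and the functional it represents is the limit of s. *)
have [y hy] := choice (fun n => embed_dense (s n) (inv_gt0 n)).
have small (e : R) : 0 < e -> exists N, forall n, (N <= n)%N ->
    fnorm cip (s n - embed (y n)) < e.
  move=> e0; have [N] := ltr_add_invr e0; rewrite add0r => hN; exists N => n nN.
  apply: lt_trans (hy n) (le_lt_trans _ hN).
  by rewrite lef_pV2 ?posrE ?ltr0n // ler_nat.
have fE a b : fnorm f (a - b) = fnorm cip (embed a - embed b).
  have -> : embed a - embed b = embed (a - b).
    by rewrite addrC -[- embed b]scaleN1r -embed_lin scaleN1r addrC.
  by rewrite /fnorm cip_embed.
have cy : cauchy_seq y.
  move=> e e0; have e3 : 0 < e / 3 by lra.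
  have [N hN] := cs _ e3; have [M hM] := small _ e3; exists (maxn N M) => m n.
  rewrite !geq_max => /andP[mN mM] /andP[nN nM].
  have := hN _ _ mN nN; have := hM _ mM; have := hM _ nM; rewrite fE.
  have -> : embed (y m) - embed (y n) =
      (embed (y m) - s m) + ((s m - s n) + (s n - embed (y n))).
    by rewrite !addrA !subrK.
  have := fnorm_triangle cip_form (embed (y m) - s m) ((s m - s n) + (s n - embed (y n))).
  have := fnorm_triangle cip_form (s m - s n) (s n - embed (y n)).
  rewrite (fnorm_sym cip_form (embed (y m))); lra.
have [F hF] := choice (fun z => cauchy_form_cvg cy (cauchy_cst z)).
have FP : (F : V -> R[i]^o) \in completion_pred by apply/asboolP; exists y.
exists (Completion FP) => e e0; have e2 : 0 < e / 2 by lra.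
have [N hN] := small _ e2.
have [M hM] := @embed_cvg y (Completion FP) (conj cy hF) _ e2.
exists (maxn N M) => n; rewrite geq_max => /andP[/hN h1 /hM h2].
have := fnorm_triangle cip_form (s n - embed (y n)) (embed (y n) - Completion FP).
rewrite addrA subrK (fnorm_sym cip_form (embed (y n))); lra.
Qed.

Lemma completion_hilbert : exists (H : hilbert R) (lam : V -> H),
  [/\ forall (a : R[i]) x y, lam (a *: x + y) = a *: lam x + lam y,
      forall x y, hip (lam x) (lam y) = f x y &
      forall (h : H) (eps : R), 0 < eps -> exists x, fnorm (@hip R H) (h - lam x) < eps].
Proof.
have [l h p] := cip_form.
have sq x : sqrtC (cip x x) = (fnorm cip x)%:C by apply: (fnormC cip_form).
have c (u : nat -> completion) :
    (forall eps : R[i], 0 < eps -> exists N : nat, forall m n : nat,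
         (N <= m)%N -> (N <= n)%N -> sqrtC (cip (u m - u n) (u m - u n)) < eps) ->
      exists l : completion, forall eps : R[i], 0 < eps -> exists N : nat, forall n : nat,
         (N <= n)%N -> sqrtC (cip (u n - l) (u n - l)) < eps.
  move=> cu; have [|k hk] := @cip_complete u.
    move=> e e0; have [|N hN] := cu e%:C; first by rewrite ltcR.
    by exists N => m n mN nN; have := hN _ _ mN nN; rewrite sq ltcR.
  exists k => e e0; have E := ge0_real (ltW e0); move: e0; rewrite E ltcR => /hk[N hN].
  by exists N => n /hN; rewrite sq ltcR.
exists (Hilbert (fun a x y z => l a x y z I I I) (fun x y => h x y I I)
  (fun x => p x I) cip_def c), embed; split.
- exact: embed_lin.
- by move=> x y; exact: cip_embed.
- exact: embed_dense.
Qed.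

End Completion.

(** * Bounds on sesquilinear forms and Hilbert space operators *)

Section SesquilinearBounds.
Context {R : realType} {V : lmodType R[i]}.

(** Polarization: the values of f on the diagonal at x + y and at ix + y are real, which forces
    [f x y] and [f y x] to be conjugate. *)
Lemma pos_sesquilinear_form (f : V -> V -> R[i]) :
  (forall (a : R[i]) x y z, f (a *: x + y) z = a * f x z + f y z) ->
  (forall (a : R[i]) x y z, f x (a *: y + z) = a^* * f x y + f x z) ->
  (forall x, 0 <= f x x) -> pos_form (fun=> True) f.
Proof.
move=> l r p; split=> // x y _ _.
have imz (z : R[i]) : 0 <= z -> complex.Im z = 0 by rewrite lecE => /andP[/eqP].
have := imz _ (p (1 *: x + y)); have := imz _ (p ('i *: x + y)).
rewrite !l !r; have := imz _ (p x); have := imz _ (p y).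
case: (f x x) (f y y) (f x y) (f y x) => [a b] [a' b'] [c d] [c' d'] /= -> -> h1 h2.
apply/eqP; rewrite eq_complex /=; apply/andP; split; apply/eqP; lra.
Qed.

(* The hermitian forms [2 K g + c f + c^* f^*] for [c = 1] and [c = i] are
   positive; Cauchy-Schwarz for both of them controls f off the diagonal. *)
Lemma sesquilinear_bound (D : V -> Prop) (g f : V -> V -> R[i]) (K : R) :
  subspace D -> pos_form D g ->
  (forall (a : R[i]) x y z, D x -> D y -> D z -> f (a *: x + y) z = a * f x z + f y z) ->
  (forall (a : R[i]) x y z, D x -> D y -> D z -> f x (a *: y + z) = a^* * f x y + f x z) ->
  0 <= K -> (forall x, D x -> normc (f x x) <= K * fnorm g x ^+ 2) ->
  forall x y, D x -> D y -> normc (f x y) <= 6 * K * fnorm g x * fnorm g y.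
Proof.
move=> sD pg fl fr K0 fK x y Dx Dy; have [gl gh gp] := pg.
pose h (c : R[i]) u v := (2 * K)%:C * g u v + (c * f u v + (c * f v u)^*).
have hD c u : normc c = 1 -> D u -> 0 <= h c u u <= ((2 * fnorm g u) ^+ 2 * K)%:C.
  move=> c1 Du; have nf : normc (c * f u u) <= K * fnorm g u ^+ 2.
    by rewrite normcM c1 mul1r; exact: fK.
  rewrite /h (form_self pg Du); move: (c * f u u) nf => z nf.
  have := Re_le_normc z; have := Re_le_normc (- z); rewrite normcN.
  move: nf; case: z => p q nf; rewrite raddfN /= => h1 h2.
  have -> : (2 * K)%:C * (fnorm g u ^+ 2)%:C + (p +i* q + (p +i* q)^*) =
      (2 * K * fnorm g u ^+ 2 + 2 * p)%:C.
    by apply/eqP; rewrite eq_complex /=; apply/andP; split; apply/eqP; ring.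
  rewrite -[X in X <= _ <= _]/(0%:C) !lecR exprMn.
  move: (fnorm g u ^+ 2) nf => G nf; apply/andP; split. lra. lra.
have ph c : normc c = 1 -> pos_form D (h c).
  move=> c1; split=> [a u v w Du Dv Dw|u v Du Dv|u Du].
  - rewrite /h gl // fl // fr //.
    case: (f u w) (f v w) (f w u) (f w v) (g u w) (g v w) a (c) =>
      [a1 b1] [a2 b2] [a3 b3] [a4 b4] [a5 b5] [a6 b6] [a7 b7] [a8 b8].
    by apply/eqP; rewrite eq_complex /=; apply/andP; split; apply/eqP; ring.
  - rewrite /h (gh u v) //; case: (g u v) (f u v) (f v u) (c) => [a b] [a' b'] [d e] [d' e'].
    by apply/eqP; rewrite eq_complex /=; apply/andP; split; apply/eqP; ring.
  - by have /andP[] := hD _ _ c1 Du.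
have nh c u : normc c = 1 -> D u -> fnorm (h c) u <= 2 * fnorm g u * Num.sqrt K.
  move=> c1 Du; rewrite -ler_sqr ?nnegrE ?mulr_ge0 ?fnorm_ge0 ?sqrtr_ge0 //.
  have /andP[_] := hD _ _ c1 Du; rewrite (form_self (ph _ c1) Du) lecR.
  by rewrite [X in _ -> _ <= X]exprMn (sqr_sqrtr K0).
have bh c : normc c = 1 -> normc (h c x y) <= 4 * K * (fnorm g x * fnorm g y).
  move=> c1; apply: le_trans (cauchy_schwarz sD (ph _ c1) Dx Dy) _.
  apply: le_trans (ler_pM (fnorm_ge0 _ _) (fnorm_ge0 _ _) (nh _ _ c1 Dx) (nh _ _ c1 Dy)) _.
  have := sqr_sqrtr K0; move: (Num.sqrt K) => k <-.
  by rewrite le_eqVlt; apply/orP; left; apply/eqP; ring.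
have n1 : normc (1 : R[i]) = 1 by exact: normc1.
have ni : normc ('i : R[i]) = 1 by rewrite /normc /= expr0n expr1n add0r sqrtr1.
have := bh _ n1; have := bh _ ni; have := cauchy_schwarz sD pg Dx Dy.
have := fnorm_ge0 g x; have := fnorm_ge0 g y.
(* Combining h at 1 with -i times h at i cancels the conjugate terms and leaves 2 f up to a multiple
   of g. Each of the three summands is at most 4 K |x| |y|, whence 12 K, and 6 K after halving. *)
have : normc (2%:C * f x y) <= normc (h 1 x y) + normc (h 'i x y) + (4 * K) * normc (g x y).
  have -> : 2%:C * f x y = h 1 x y + (- 'i * h 'i x y + (2 * K)%:C * ('i - 1) * g x y).
    rewrite /h; case: (g x y) (f x y) (f y x) => [a b] [a' b'] [c d].
    by apply/eqP; rewrite eq_complex /=; apply/andP; split; apply/eqP; ring.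
  have := le_normcD (h 1 x y) (- 'i * h 'i x y + (2 * K)%:C * ('i - 1) * g x y).
  have := le_normcD (- 'i * h 'i x y) ((2 * K)%:C * ('i - 1) * g x y).
  rewrite !normcM normcN ni normc_real mul1r ger0_norm; last lra.
  have := le_normcD ('i : R[i]) (- 1); rewrite normcN ni n1 => h1.
  have : 2 * K * normc ('i - 1 : R[i]) * normc (g x y) <= 4 * K * normc (g x y).
    by rewrite ler_wpM2r ?normc_ge0 //; nra.
  lra.
rewrite normcM normc_real ger0_norm; last lra.
nra.
Qed.

End SesquilinearBounds.

(** * Norm estimates in a Hilbert space from a dense subspace *)

Section HilbertFacts.
Context {R : realType} (H : hilbert R).
Implicit Types (x y : H) (D : H -> Prop).

Notation N := (fnorm (@hip R H)).

Lemma hip_form : pos_form (fun=> True) (@hip R H).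
Proof.
by split=> *; [exact: hip_linear | exact: hip_herm | exact: hip_ge0].
Qed.

Lemma hnormE x : hnorm x = (N x)%:C.
Proof. exact: (fnormC hip_form). Qed.

Lemma hnorm_lt x (eps : R[i]) : 0 < eps -> (hnorm x < eps) = (N x < complex.Re eps).
Proof. by move=> e0; rewrite hnormE [eps in LHS]ge0_real ?ltcR // ltW. Qed.

Lemma Re_gt0 (eps : R[i]) : 0 < eps -> 0 < complex.Re eps.
Proof. by rewrite ltcE => /andP[]. Qed.

Lemma fnorm_eq0 x : N x = 0 -> x = 0.
Proof. by move=> x0; apply: hip_def; rewrite (fnorm_sqr hip_form) x0 expr0n. Qed.

Lemma dense_approx D : dense_subspace D -> forall x (e : R), 0 < e ->
  exists y, D y /\ N (x - y) < e.
Proof.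
move=> [_ [_ d]] x e e0; have [|y [Dy]] := d x e%:C; first by rewrite ltcR.
by rewrite hnormE ltcR => xy; exists y.
Qed.

Lemma dense_functional_bound D x (K : R) : dense_subspace D -> 0 <= K ->
  (forall y, D y -> normc (hip x y) <= K * N y) -> N x <= K.
Proof.
move=> dD K0 h; rewrite leNgt; apply/negP => Kx.
have a0 : 0 < N x + K by lra.
(* With d = |x - y| the hypothesis gives |x|^2 <= |x| d + K (|x| + d); this threshold for d is
   exactly where the right-hand side would drop below |x|^2. *)
have e0 : 0 < N x * (N x - K) / (N x + K) by rewrite divr_gt0 // mulr_gt0; lra.
have [y [Dy]] := dense_approx dD x e0; rewrite ltr_pdivlMr // => xy.
have := h _ Dy; have := form_normc_le hip_form x (x - y).
have : N y <= N x + N (x - y).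
  have := fnorm_triangle hip_form x (y - x); rewrite (fnorm_sym hip_form y).
  by rewrite addrC subrK.
have : N x ^+ 2 <= normc (hip x (x - y)) + normc (hip x y).
  have -> : N x ^+ 2 = complex.Re (hip x (x - y) + hip x y).
    by rewrite (formBr hip_form) subrK (fnorm_sqr hip_form).
  exact: le_trans (Re_le_normc _) (le_normcD _ _).
nra.
Qed.

Lemma dense_orthogonal D x : dense_subspace D -> (forall y, D y -> hip x y = 0) -> x = 0.
Proof.
move=> dD h; apply: fnorm_eq0; apply/eqP; rewrite eq_le fnorm_ge0 andbT.
by apply: dense_functional_bound dD _ _ => // y /h ->; rewrite normc0 mul0r.
Qed.

Lemma closure_norm_bound D (X : H -> H) (K : R) : 0 <= K ->
  (forall x, D x -> N (X x) <= K * N x) -> closure_norm_le D X K%:C.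
Proof.
move=> K0 h xi eta [u [Du [ux Xu]]]; rewrite !hnormE -rmorphM /= lecR.
apply/ler_addgt0Pr => e e0.
(* An error d in both [u n] and [X (u n)] perturbs the estimate by (K + 1) d in total. *)
have d0 : 0 < e / (K + 1) by rewrite divr_gt0 //; lra.
have d0C : 0 < (e / (K + 1))%:C by rewrite ltcR.
have [n1 h1] := ux _ d0C; have [n2 h2] := Xu _ d0C; set n := maxn n1 n2.
have := h _ (Du n); have := h1 n (leq_maxl _ _); have := h2 n (leq_maxr _ _).
rewrite !hnorm_lt //= => i1 i2 i3.
have := fnorm_triangle hip_form (eta - X (u n)) (X (u n)); rewrite subrK.
have := fnorm_triangle hip_form (u n - xi) xi; rewrite subrK.
rewrite (fnorm_sym hip_form eta).
have : e = (K + 1) * (e / (K + 1)) by rewrite mulrC divfK //; lra.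
move: (e / (K + 1)) i1 i2 => d i1 i2 ->; nra.
Qed.

End HilbertFacts.

(** * Forms and representations of a partial *-algebra *)

Section Seminorms.
Context {R : realType} {A : lmodType R[i]} {I : Type} (sn : I -> A -> R).
Hypothesis sn_seminorm : forall i, seminorm (sn i).

Lemma seminormZ (p : A -> R) (t : R) x : seminorm p -> 0 <= t -> p (t%:C *: x) = t * p x.
Proof.
move=> [_ [_ h]] t0; apply: (@complexI R); rewrite h normC_normc normc_real.
by rewrite ger0_norm // rmorphM.
Qed.

Lemma sum_seminorm_ge0 s x : 0 <= \sum_(i <- s) sn i x.
Proof. by apply: sumr_ge0 => i _; have [] := sn_seminorm i. Qed.

Lemma le_sum_seminorm s i x : List.In i s -> sn i x <= \sum_(i <- s) sn i x.
Proof.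
elim: s => //= j s IH [->|/IH h]; rewrite big_cons.
  by rewrite lerDl sum_seminorm_ge0.
by apply: le_trans h _; rewrite lerDr; have [] := sn_seminorm j.
Qed.

(** By homogeneity: with S the sum of the seminorms of x, dividing x by S/d + e moves it into the
    neighbourhood, so p x < S/d + e. The extra e > 0 covers S = 0. *)
Lemma near0_tau_cont_seminorm (p : A -> R) s (d : R) : seminorm p -> 0 < d ->
  (forall x, tau_near sn s d 0 x -> p x < 1) -> tau_cont_seminorm sn p.
Proof.
move=> sp d0 h; split=> //; exists s, d^-1; split; first by rewrite invr_gt0.
move=> x; apply/ler_addgt0Pr => e e0; set S := \sum_(_ <- _) _.
have S0 : 0 <= S := sum_seminorm_ge0 s x.
have t0 : 0 < d^-1 * S + e by rewrite ltr_wpDl // mulr_ge0 // invr_ge0 ltW.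
have t1 : 0 <= (d^-1 * S + e)^-1 by rewrite invr_ge0 ltW.
have : p ((d^-1 * S + e)^-1%:C *: x) < 1.
  apply: h => i si; rewrite subr0 seminormZ //.
  apply: le_lt_trans (ler_wpM2l t1 (le_sum_seminorm x si)) _.
  rewrite -/S mulrC ltr_pdivrMr // mulrDr mulVKf ?gt_eqF //.
  by rewrite ltrDl mulr_gt0.
by rewrite seminormZ // mulrC ltr_pdivrMr // mul1r => /ltW.
Qed.

Lemma tau_near_app s s' (d d' : R) x y :
  tau_near sn (List.app s s') (Num.min d d') x y ->
  tau_near sn s d x y /\ tau_near sn s' d' x y.
Proof.
move=> h; split=> i si.
  by have := h i (List.in_or_app _ _ _ (or_introl si)); rewrite lt_min => /andP[].
by have := h i (List.in_or_app _ _ _ (or_intror si)); rewrite lt_min => /andP[].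
Qed.

Lemma tau_continuous_sum (f : A -> A) x0 (s : seq I) (eps : R) :
  tau_continuous sn f -> 0 < eps -> exists (s' : seq I) (d : R), 0 < d /\
    forall x, tau_near sn s' d x0 x -> \sum_(i <- s) sn i (f x - f x0) < eps.
Proof.
move=> cf; elim: s eps => [|j s IH] eps e0.
  by exists [::], 1; split=> // x _; rewrite big_nil.
have e2 : 0 < eps / 2 by lra.
have [s1 [d1 [d10 h1]]] := IH _ e2; have [s2 [d2 [d20 h2]]] := cf x0 j _ e2.
exists (List.app s1 s2), (Num.min d1 d2); split; first by rewrite lt_min d10.
move=> x /tau_near_app[/h1 n1 /h2 n2]; rewrite big_cons; lra.
Qed.

End Seminorms.

(** * Order bounds, representations and P-boundedness *)

Section PartialStarAlgebra.
Context {R : realType} {A : lmodType R[i]} (star : A -> A)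
  (G : A -> A -> Prop) (mul : A -> A -> A) {I : Type} (sn : I -> A -> R)
  (B : A -> Prop) (e : A).
Hypotheses (topA : topological_partial_star_algebra star G mul sn)
  (sassA : semi_associative G mul)
  (coreB : multiplication_core star G mul sn B e)
  (unitA : is_unit star G mul e).

Let starK : forall x, star (star x) = x. Proof. by case: topA => -[]. Qed.
Let G_star x y : G x y -> G (star y) (star x).
Proof. by case: topA => -[_ [_ [h _]]] _ /h. Qed.
Let star_mul x y : G x y -> star (mul x y) = mul (star y) (star x).
Proof. by case: topA => -[_ [_ [_ [h _]]]] _; exact: h. Qed.
Let sn_seminorm i : seminorm (sn i).
Proof. by case: topA => _ [[]]. Qed.
Let B_subspace : subspace B.
Proof. by case: coreB. Qed.
Let GB x b : B b -> G x b.
Proof. by case: coreB => _ [h _] /h; apply. Qed.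
Let Be : B e. Proof. by case: coreB => _ [_ []]. Qed.
Let muleA x : mul x e = x. Proof. by case: unitA => _ [_ [_ h]]; case: (h x). Qed.
Let emulA x : mul e x = x. Proof. by case: unitA => _ [_ [_ h]]; case: (h x). Qed.
Let Ge x : G e x. Proof. by case: unitA => _ [_ [h _]]. Qed.
Let stare : star e = e. Proof. by case: unitA. Qed.

Let GstarB x b : B b -> G (star b) x.
Proof. by move=> Bb; rewrite -[x]starK; exact/G_star/GB. Qed.

Let mulDl (a : R[i]) x y b : B b -> mul (a *: x + y) b = a *: mul x b + mul y b.
Proof.
move=> Bb; case: topA => -[_ [_ [_ [_ [_ h]]]]] _.
by have [_] := h b x y a 1 (GB x Bb) (GB y Bb); rewrite !scale1r.
Qed.

Let mulDr (a : R[i]) x b c : B b -> B c -> mul x (a *: b + c) = a *: mul x b + mul x c.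
Proof.
move=> Bb Bc; case: topA => -[_ [_ [_ [_ [h _]]]]] _.
by have [_] := h x b c a 1 (GB x Bb) (GB x Bc); rewrite !scale1r.
Qed.

Let B_mulB x b c : B b -> B c -> mul (star b) (mul x c) = mul (mul (star b) x) c.
Proof. by case: coreB => _ [_ [_ [_ [_ [_ h]]]]]; exact: h. Qed.

Lemma ips_pos_form phi : ips_form star G mul B phi -> pos_form (fun=> True) phi.
Proof. by move=> [l [r [p _]]]; exact: pos_sesquilinear_form. Qed.

Lemma core_approx phi x (eps : R) : ips_form star G mul B phi -> 0 < eps ->
  exists b, B b /\ fnorm phi (x - b) < eps.
Proof.
move=> ip e0; have [_ [_ [_ [_ [d _]]]]] := ip.
have [|b [Bb xb]] := d x (eps ^+ 2)%:C; first by rewrite ltcR exprn_gt0.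
exists b; split=> //; rewrite -ltr_sqr ?nnegrE ?fnorm_ge0 ?(ltW e0) //.
by move: xb; rewrite (fnorm_sqr (ips_pos_form ip)) ltcR.
Qed.

Lemma phi_mul_lin phi (a : A) (k : R[i]) x y : ips_form star G mul B phi -> B a ->
  phi (mul (k *: x + y) a) a = k * phi (mul x a) a + phi (mul y a) a.
Proof. by move=> /ips_pos_form pf Ba; rewrite mulDl // (formlin pf). Qed.

(** One identity serves all four order inequalities: plus or minus [ReA x] and [ImA x] are c x plus
    its adjoint, for c = 1/2, -i/2 and their opposites. The adjoint law turns the [star x] term into
    a conjugate. *)
Lemma ips_order_gap phi a (g : R) (c : R[i]) x : ips_form star G mul B phi -> B a ->
  phi (mul (g%:C *: e + (- c *: x + (- c^*) *: star x)) a) a =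
  (g * fnorm phi a ^+ 2 - 2 * complex.Re (c * phi (mul x a) a))%:C.
Proof.
move=> ip Ba; have pf := ips_pos_form ip; have [_ [_ [_ [_ [_ [s _]]]]]] := ip.
have z0 : phi (mul 0 a) a = 0.
  have := phi_mul_lin (-1) 0 0 ip Ba; rewrite scaler0 addr0.
  by rewrite mulN1r addNr.
rewrite -[X in - c *: x + X]addr0 !phi_mul_lin // z0 addr0 emulA.
have -> : phi (mul (star x) a) a = (phi (mul x a) a)^*.
  by rewrite s // starK (form_conj pf).
rewrite (fnorm_sqr pf); case: c (phi _ _) => [p q] [p' q'].
by apply/eqP; rewrite eq_complex /=; apply/andP; split; apply/eqP; ring.
Qed.

Lemma Apos_gap (g : R) (c d : R[i]) x : c^* = d ->
  (Apos star G mul sn B (g%:C *: e + (- c *: x + (- d) *: star x)) <->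
   forall phi a, in_P star G mul sn B phi -> B a ->
     2 * complex.Re (c * phi (mul x a) a) <= g * fnorm phi a ^+ 2).
Proof.
move=> <-.
have E phi a : in_P star G mul sn B phi -> B a ->
    (0 <= phi (mul (g%:C *: e + (- c *: x + (- c^*) *: star x)) a) a) =
    (2 * complex.Re (c * phi (mul x a) a) <= g * fnorm phi a ^+ 2).
  by move=> [ip _] Ba; rewrite ips_order_gap // (lecR 0) subr_ge0.
by split=> h phi a phiP Ba; [rewrite -E //; exact: h | rewrite E //; exact: h].
Qed.

(** Replaces the order by scalar bounds on the quadratic forms of x, which is how both implications
    involving [in_Ab] use it. *)
Lemma in_AbE x : in_Ab star G mul sn B e x <-> exists g : R, 0 <= g /\
  forall phi a, in_P star G mul sn B phi -> B a ->
    `|complex.Re (phi (mul x a) a)| <= g * fnorm phi a ^+ 2 /\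
    `|complex.Im (phi (mul x a) a)| <= g * fnorm phi a ^+ 2.
Proof.
pose c : R[i] := (2^-1)%:C; pose d : R[i] := 0 -i* 2^-1.
have ReE : ReA star x = c *: (x + star x).
  by rewrite /ReA; congr (_ *: _); rewrite /c fmorphV rmorph_nat.
have ImE : ImA star x = d *: (x - star x).
  rewrite /ImA; congr (_ *: _).
  have n0 : 2 * 'i != 0 :> R[i].
    by rewrite mulf_neq0 ?pnatr_eq0 //; apply/eqP => -[] /eqP; rewrite oner_eq0.
  apply: (mulfI n0); rewrite mulfV //.
  have -> : 2 = (2 : R)%:C :> R[i] by rewrite rmorph_nat.
  by apply/eqP; rewrite eq_complex /=; apply/andP; split; apply/eqP; field.
have conjN (z : R[i]) : (- z)^* = - z^* by case: z.
have cc : c^* = c by rewrite conjc_real.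
have dc : d^* = - d by apply/eqP; rewrite eq_complex /= oppr0 !eqxx.
have ccN : (- c)^* = - c by rewrite conjN; congr (- _).
have dcN : (- d)^* = d by rewrite conjN -[RHS]opprK; congr (- _).
have rc (z : R[i]) : 2 * complex.Re (c * z) = complex.Re z by case: z => p q /=; lra.
have rd (z : R[i]) : 2 * complex.Re (d * z) = complex.Im z by case: z => p q /=; lra.
have rN (z z' : R[i]) : 2 * complex.Re (- z * z') = - (2 * complex.Re (z * z')).
  by rewrite mulNr raddfN /= mulrN.
have E1 g : g *: e - ReA star x = g *: e + (- c *: x + (- c) *: star x).
  by rewrite ReE scalerDr !scaleNr opprD.
have E2 g : g *: e - - ReA star x = g *: e + (- - c *: x + (- - c) *: star x).
  by rewrite ReE scalerDr !opprK.
have E3 g : g *: e - ImA star x = g *: e + (- d *: x + (- - d) *: star x).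
  by rewrite ImE scalerBr opprD !opprK scaleNr.
have E4 g : g *: e - - ImA star x = g *: e + (- - d *: x + (- d) *: star x).
  by rewrite ImE scalerBr !opprK scaleNr.
split=> -[g [g0 h]]; exists g; split=> //.
  move: h; rewrite /Ale E1 E2 E3 E4 => -[/(Apos_gap _ _ cc) h1].
  move=> [/(Apos_gap _ _ ccN) h2 [/(Apos_gap _ _ dc) h3 /(Apos_gap _ _ dcN) h4]].
  move=> phi a phiP Ba; rewrite !ler_norml.
  have := h1 _ _ phiP Ba; have := h2 _ _ phiP Ba; rewrite rN rc.
  have := h3 _ _ phiP Ba; have := h4 _ _ phiP Ba; rewrite rN rd.
  by move=> i1 i2 i3 i4; split; apply/andP; split; lra.
rewrite /Ale E1 E2 E3 E4; split; last split; last split.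
- apply/(Apos_gap _ _ cc) => phi a phiP Ba.
  by have [] := h _ _ phiP Ba; rewrite !ler_norml rc; lra.
- apply/(Apos_gap _ _ ccN) => phi a phiP Ba.
  by have [] := h _ _ phiP Ba; rewrite !ler_norml rN rc; lra.
- apply/(Apos_gap _ _ dc) => phi a phiP Ba.
  by have [] := h _ _ phiP Ba; rewrite !ler_norml rd; lra.
- apply/(Apos_gap _ _ dcN) => phi a phiP Ba.
  by have [] := h _ _ phiP Ba; rewrite !ler_norml rN rd; lra.
Qed.

Lemma P_bounded_in_Ab x : P_bounded star G mul sn B x -> in_Ab star G mul sn B e x.
Proof.
move=> [gamma [g0 h]]; apply/in_AbE; exists (complex.Re gamma).
have gE := ge0_real (ltW g0); split; first by move: g0; rewrite ltcE => /andP[_ /ltW].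
move=> phi a phiP Ba; have [ip _] := phiP; have pf := ips_pos_form ip.
have := h _ _ _ phiP Ba Ba; rewrite gE !(fnormC pf) // normC_normc -!rmorphM lecR /=.
rewrite -mulrA -expr2 => H.
by split; apply: le_trans H; [exact: norm_Re_le | exact: norm_Im_le].
Qed.

(** * Vector forms of a continuous representation and the bound they give *)

Section Representation.
Variables (H : hilbert R) (D : H -> Prop) (pi : A -> H -> H).
Hypothesis rep : cont_star_rep star G mul sn D pi.

Notation N := (fnorm (@hip R H)).

Let rep_dense : dense_subspace D. Proof. by case: rep => -[]. Qed.

Let rep_linear x (a : R[i]) xi eta : D xi -> D eta ->
  pi x (a *: xi + eta) = a *: pi x xi + pi x eta.
Proof. by case: rep => -[_ [h _]] _; exact: h. Qed.

Let rep_add (a : R[i]) x y xi : D xi -> pi (a *: x + y) xi = a *: pi x xi + pi y xi.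
Proof. by case: rep => -[_ [_ [h _]]] _; exact: h. Qed.

Let rep0 xi : D xi -> pi 0 xi = 0.
Proof.
move=> Dxi; have := rep_add (-1) 0 0 Dxi.
by rewrite scaler0 addr0 scaleN1r addNr.
Qed.

Let repZ (a : R[i]) x xi : D xi -> pi (a *: x) xi = a *: pi x xi.
Proof. by move=> Dxi; have := rep_add a x 0 Dxi; rewrite rep0 // !addr0. Qed.

Let repB x y xi : D xi -> pi (x - y) xi = pi x xi - pi y xi.
Proof. by move=> Dxi; rewrite addrC -scaleN1r rep_add // scaleN1r addrC. Qed.

Let rep_hip x y xi : D xi -> G (star x) y ->
  hip (pi x xi) (pi y xi) = hip xi (pi (mul (star x) y) xi).
Proof.
move=> Dxi Gxy; case: rep => -[_ [_ [_ [_ h]]]] _.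
by have [_ [_ /(_ _ Dxi xi Dxi)]] := h _ _ Gxy; rewrite starK.
Qed.

Lemma rep_vector_seminorm xi : D xi -> tau_cont_seminorm sn (fun x => N (pi x xi)).
Proof.
move=> Dxi; have [_ cont] := rep.
have [s [d [d0 h]]] := cont _ Dxi 0 1 ltr01.
have small x : tau_near sn s d 0 x -> N (pi x xi) < 1.
  by move=> /h; rewrite rep0 // subr0 hnorm_lt.
apply: (near0_tau_cont_seminorm sn_seminorm _ d0 small).
split=> [x|]; first exact: fnorm_ge0.
split=> [x y|a x]; last by rewrite repZ // (fnormZ (hip_form H)) normC_normc rmorphM.
have := rep_add 1 x y Dxi; rewrite !scale1r => ->.
exact: (fnorm_triangle (hip_form H)).
Qed.

Lemma rep_vector_form xi : D xi ->
  in_P star G mul sn B (fun x y => hip (pi x xi) (pi y xi)).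
Proof.
move=> Dxi; split; last first.
  exists (fun x => N (pi x xi)); split; first exact: rep_vector_seminorm.
  by move=> x y; rewrite normC_normc lecR (form_normc_le (hip_form H)).
split=> [a x y z|]; first by rewrite rep_add // (formlin (hip_form H)).
split=> [a x y z|].
  by rewrite rep_add // hip_herm (formlin (hip_form H)) rmorphD rmorphM /= -!hip_herm.
split=> [x|]; first exact: hip_ge0.
split=> [b Bb x|]; first exact: GB.
split=> [x eps e0|].
  have [_ cont] := rep; have s0 : 0 < Num.sqrt (complex.Re eps).
    by rewrite sqrtr_gt0; exact: Re_gt0.
  have s0C : 0 < (Num.sqrt (complex.Re eps))%:C by rewrite ltcR.
  have [s [d [d0 h]]] := cont _ Dxi x _ s0C.
  case: coreB => _ [_ [_ [_ [dense _]]]]; have [b [Bb bx]] := dense x s d d0.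
  exists b; split=> //; have := h b (fun i si => (bx i si).1).
  rewrite hnorm_lt //= repB // (fnorm_sqr (hip_form H)) (fnorm_sym (hip_form H)).
  rewrite [eps]ge0_real ?(ltW e0) // ltcR => lt.
  by rewrite -[ltRHS]sqr_sqrtr ?ltr_sqr ?nnegrE ?fnorm_ge0 ?sqrtr_ge0 // ltW // Re_gt0.
split=> [x a b Ba Bb|x y a b Gxy Ba Bb].
  rewrite !rep_hip //; [|exact: GstarB|exact: GB].
  by rewrite star_mul ?B_mulB //; exact: GB.
(* With s = [star a], the aim is (s x)(y b) = ((s x) y) b = (s (x y)) b = s ((x y) b). The first
   equality is semi-associativity ([m3]), the second is the involution applied to semi-associativity
   for [star y], [star x], a ([m2]), and the third is the core identity. *)
have GRA z : B z -> RA G z by move=> Bz t; exact: GB.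
have [G1 m1] := sassA (G_star Gxy) (GRA _ Ba).
have Gxa : star (mul (star x) a) = mul (star a) x by rewrite star_mul ?starK //; exact: GB.
have := G_star G1; rewrite Gxa starK => G2.
have m2 : mul (mul (star a) x) y = mul (star a) (mul x y).
  have := congr1 star m1; rewrite -star_mul // (star_mul G1) Gxa starK => <-.
  by rewrite star_mul ?starK //; exact: GB.
have [G3 m3] := sassA G2 (GRA _ Bb).
rewrite !rep_hip //; [|exact: GstarB|by rewrite Gxa].
by rewrite Gxa -m3 m2 -B_mulB.
Qed.

(** The hypothesis, used for the vector form of xi at a = [e], bounds |<pi x xi, xi>| by g |xi|^2
    once [ne] and [ze] remove [pi e]. [sesquilinear_bound] then passes to pairs of vectors, and
    density of D to the norm. *)
Lemma rep_numerical_radius x (g : R) : 0 <= g ->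
  (forall phi a, in_P star G mul sn B phi -> B a ->
    normc (phi (mul x a) a) <= g * fnorm phi a ^+ 2) ->
  forall xi, D xi -> N (pi x xi) <= 6 * g * N xi.
Proof.
move=> g0 h xi Dxi; have hf := hip_form H.
have ne eta : D eta -> N (pi e eta) <= N eta.
  move=> De; have := form_normc_le hf eta (pi e eta).
  have : hip (pi e eta) (pi e eta) = hip eta (pi e eta).
    by rewrite rep_hip ?stare // emulA.
  move=> <-; rewrite (fnorm_sqr hf) normc_real ger0_norm ?sqr_ge0 // expr2.
  have := fnorm_ge0 (@hip R H) (pi e eta); rewrite le_eqVlt => /orP[/eqP <- _|n0].
    exact: fnorm_ge0.
  by rewrite ler_pM2r.
have ze eta : D eta -> hip (pi x eta) (pi e eta) = hip (pi x eta) eta.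
  by move=> De; rewrite hip_herm rep_hip ?stare // emulA -hip_herm.
have dD := rep_dense; have [D0 [Dl _]] := dD.
apply: dense_functional_bound dD _ _; first by rewrite !mulr_ge0 ?fnorm_ge0.
move=> eta Deta.
apply: (sesquilinear_bound (D := D) (g := @hip R H)
  (f := fun u v => hip (pi x u) v) _ _ _ _ g0) => //.
- by split=> *; [exact: hip_linear | exact: hip_herm | exact: hip_ge0].
- by move=> a u v w Du Dv Dw; rewrite rep_linear // hip_linear.
- move=> a u v w Du Dv Dw.
  by rewrite hip_herm hip_linear rmorphD rmorphM /= -!hip_herm.
move=> u Du; have := h _ _ (rep_vector_form Du) Be; rewrite muleA ze //.
move=> hu; apply: le_trans hu _; rewrite ler_wpM2l //.
by rewrite ler_sqr ?nnegrE ?fnorm_ge0 //; exact: ne.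
Qed.

End Representation.

Lemma in_Ab_rep_bounded x : in_Ab star G mul sn B e x -> rep_bounded star G mul sn x.
Proof.
(* The 2 adds the bounds on the real and imaginary parts; the 6 comes from
   [rep_numerical_radius]. *)
move=> /in_AbE[g [g0 h]]; have K0 : 0 <= 6 * (2 * g) by lra.
have bd (H : hilbert R) D pi : cont_star_rep star G mul sn (H := H) D pi ->
    forall xi, D xi -> fnorm (@hip R H) (pi x xi) <= 6 * (2 * g) * fnorm (@hip R H) xi.
  move=> rep; apply: rep_numerical_radius rep _ _ _ _; first lra.
  move=> phi a phiP Ba; have [h1 h2] := h _ _ phiP Ba.
  by apply: le_trans (normc_le _) _; lra.
split=> [H D pi rep|].
  exists (6 * (2 * g))%:C => xi Dxi; rewrite !hnormE -rmorphM /= lecR.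
  exact: bd rep _ _.
exists (6 * (2 * g))%:C => H D pi rep; apply: closure_norm_bound => // xi.
exact: bd rep _.
Qed.

(** * The GNS representation of a form in P *)

Section GNS.
Variable phi : A -> A -> R[i].
Hypothesis phiP : in_P star G mul sn B phi.

Lemma gns : exists (H : hilbert R) (D : H -> Prop) (pi : A -> H -> H) (lam : A -> H),
  [/\ cont_star_rep star G mul sn D pi,
      forall x y, hip (lam x) (lam y) = phi x y,
      forall b, B b -> D (lam b) &
      forall x b, B b -> pi x (lam b) = lam (mul x b)].
Proof.
have [ip [p [[p_sn [s [c [c0 ps]]]] phip]]] := phiP; have pf := ips_pos_form ip.
have [_ [_ [_ [_ [_ [adj prod]]]]]] := ip.
have [H [lam [laml lamh lamd]]] := completion_hilbert pf; have hf := hip_form H.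
have lamB x y : lam (x - y) = lam x - lam y.
  by rewrite addrC -scaleN1r laml scaleN1r addrC.
have lamN x : fnorm (@hip R H) (lam x) = fnorm phi x by rewrite /fnorm lamh.
pose D h := exists b, B b /\ h = lam b.
have DB b : B b -> D (lam b) by move=> Bb; exists b.
have dD : dense_subspace D.
  have lam0 : lam 0 = 0 by rewrite -[0 in LHS](subrr 0) lamB subrr.
  split; first by exists 0; split=> //; exact: B_subspace.1.
  split=> [a _ _ [x [Bx ->]] [y [By ->]]|h eps e0].
    by exists (a *: x + y); rewrite laml; split=> //; exact: B_subspace.2.
  have e2 : 0 < complex.Re eps / 2 by rewrite divr_gt0 // Re_gt0.
  have [x hx] := lamd h _ e2; have [b [Bb xb]] := core_approx x ip e2.
  exists (lam b); split; first exact: DB.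
  rewrite hnorm_lt //; have := fnorm_triangle hf (h - lam x) (lam x - lam b).
  by rewrite addrA subrK -lamB lamN; lra.
(* Against [lam d] with d in B the pairing equals that of [lam b] with [lam (mul (star x) d)], so it
   depends on [lam b] alone; density of D concludes. *)
have wd x b b' : B b -> B b' -> lam b = lam b' -> lam (mul x b) = lam (mul x b').
  move=> Bb Bb' bb'; apply/eqP; rewrite -subr_eq0; apply/eqP.
  apply: dense_orthogonal dD _ => _ [d [Bd ->]].
  by rewrite (formBl hf) !lamh !adj // -!lamh bb' subrr.
(* A preimage in B is chosen, harmlessly by [wd]; the value 0 off D is a filler. *)
pose pi x h := if pselect (D h) is left Dh then lam (mul x (projT1 (cid Dh))) else 0.
have piE x b : B b -> pi x (lam b) = lam (mul x b).
  move=> Bb; rewrite /pi; case: pselect => [Db|[]]; last exact: DB.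
  by case: cid => b' /= [Bb' E]; apply: wd.
exists H, D, pi, lam; split=> //; split; last first.
  move=> _ [b [Bb ->]] x0 eps e0.
  have tc : tau_continuous sn (fun x => mul x b).
    by case: coreB => _ [_ [_ [_ [_ [h _]]]]]; exact: h.
  (* The norm of [lam z] is at most p z, itself at most c times a finite sum of generating
     seminorms; hence the division by c. *)
  have ec : 0 < complex.Re eps / c by rewrite divr_gt0 // Re_gt0.
  have [s' [d [d0 h]]] := tau_continuous_sum x0 s tc ec.
  exists s', d; split=> // x /h lt; rewrite hnorm_lt // !piE // -lamB lamN.
  have le : fnorm phi (mul x b - mul x0 b) <= p (mul x b - mul x0 b).
    rewrite -ler_sqr ?nnegrE ?fnorm_ge0 //; last by case: p_sn.
    have := phip (mul x b - mul x0 b) (mul x b - mul x0 b).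
    by rewrite normC_normc lecR (fnorm_sqr pf) normc_real ger0_norm ?sqr_ge0.
  apply: le_lt_trans le (le_lt_trans (ps _) _).
  by rewrite mulrC -ltr_pdivlMr.
split=> //; split=> [x a _ _ [b [Bb ->]] [b' [Bb' ->]]|].
  by rewrite -laml !piE // ?mulDr ?laml //; exact: B_subspace.2.
split=> [x y a _ [b [Bb ->]]|]; first by rewrite !piE // mulDl // laml.
split=> [x _ _ [b [Bb ->]] [b' [Bb' ->]]|x y Gxy]; first by rewrite !piE // !lamh adj.
have prodD xi : D xi -> adj_rel D (pi (star x)) (pi y xi) (pi (mul x y) xi).
  move=> [b [Bb ->]] _ [a [Ba ->]]; rewrite !piE // !lamh; exact: prod.
split; first by move=> xi Dxi; exists (pi (mul x y) xi); exact: prodD.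
split=> // _ zeta [b [Bb ->]] bz.
(* Since D is dense, an adjoint vector is unique, and the adjoint law exhibits this one. *)
have -> : zeta = lam (mul (star x) b).
  apply/eqP; rewrite -subr_eq0; apply/eqP; apply: dense_orthogonal dD _.
  move=> _ [a [Ba ->]]; rewrite hip_herm (formBr hf) -bz ?piE ?lamh ?adj //; last exact: DB.
  by rewrite subrr rmorph0.
(* The witness is the value at [lam b] of the representative of [star (mul x y)]; the product law of
   [phi], conjugated, moves y across. *)
exists (lam (mul (star (mul x y)) b)) => _ [a [Ba ->]].
by rewrite piE // !lamh -[RHS]adj // (form_conj pf) prod // -(form_conj pf).
Qed.

End GNS.

Lemma rep_bounded_P_bounded x : rep_bounded star G mul sn x -> P_bounded star G mul sn B x.
Proof.
(* M is an arbitrary complex number, so its modulus takes its place; adding 1 makes the bound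
   strictly positive. *)
move=> [_ [M hM]]; exists (normc M + 1)%:C.
have M0 := normc_ge0 M; split; first by rewrite ltcR; lra.
move=> phi a b phiP Ba Bb; have [ip _] := phiP; have pf := ips_pos_form ip.
have [H [D [pi [lam [rep lamh DB piE]]]]] := gns phiP; have hf := hip_form H.
have lamN y : fnorm (@hip R H) (lam y) = fnorm phi y by rewrite /fnorm lamh.
have cst (h : H) : hconv (fun=> h) h.
  move=> eps e0; exists 0%N => n _; rewrite hnorm_lt // subrr.
  by rewrite (fnorm0 hf) Re_gt0.
have := hM _ _ _ rep (lam a) (pi x (lam a)).
(* The bound concerns the closure of [pi x]; a constant sequence brings it back to the vector
   [lam a] of D. *)
have cg : closure_graph D (pi x) (lam a) (pi x (lam a)).
  by exists (fun=> lam a); split; [move=> _; exact: DB | split; exact: cst].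
move=> /(_ cg); rewrite !hnormE piE // !lamN => le.
have {}le : fnorm phi (mul x a) <= normc M * fnorm phi a.
  have /le_normC : (fnorm phi (mul x a))%:C <= M * (fnorm phi a)%:C by [].
  by rewrite normcM !normc_real !ger0_norm ?fnorm_ge0.
rewrite !(fnormC pf) // normC_normc -!rmorphM lecR /=.
apply: le_trans (form_normc_le pf _ _) _; rewrite ler_wpM2r ?fnorm_ge0 //.
by have := fnorm_ge0 phi a; nra.
Qed.

End PartialStarAlgebra.

Theorem theorem5p22 (R : realType) (A : lmodType R[i]) (star : A -> A)
  (G : A -> A -> Prop) (mul : A -> A -> A) (I : Type) (sn : I -> A -> R)
  (B : A -> Prop) (e : A) :
  topological_partial_star_algebra star G mul sn ->
  semi_associative G mul ->
  multiplication_core star G mul sn B e ->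
  is_unit star G mul e ->
  star_semisimple star G mul sn ->
  forall x : A,
    [<-> P_bounded star G mul sn B x;
         in_Ab star G mul sn B e x;
         rep_bounded star G mul sn x].
Proof.
move=> topA sassA coreB unitA _ x; tfae.
- exact: P_bounded_in_Ab topA coreB unitA x.
- exact: in_Ab_rep_bounded topA sassA coreB unitA x.
- exact: rep_bounded_P_bounded topA coreB x.
Qed.
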